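(* Let $\beta$ be an abstract regular $n$-polytope with automorphism group $B=\langle\rho_0,\ldots,\rho_{n-1}\rangle$ (distinguished generators), viewed as the coset incidence system $(B,(B_i)_{0\le i\le n-1})$ with $B_i=\langle\rho_k\mid k\ne i\rangle$. Suppose that $\beta$ has finitely many, and more than one, $0$-elements, and let $\mathcal{D}=\mathcal{D}(\beta,0,\lambda)$ be a $0$-diagonal Coxeter graph of $\beta$, for some label function $\lambda:\mathcal{C}^0_\beta\to\{2,3,\ldots\}\cup\{\infty\}$. Choose the base vertex $F_L=B_0$. Then $$2^{\beta,\mathcal{D}}\cong\mathcal{T}(\alpha,\beta),$$ where $\alpha$ is the standard coset incidence system of $W(\mathcal{D})$ and the twisting is taken with respect to the induced action $\eta$ of $B$ on $W(\mathcal{D})$.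
   Context: Coset incidence systems. Given a group $B$ and a family $(B_i)_{i\in I_\beta}$ of subgroups (the maximal parabolic subgroups), the coset incidence system $(B,(B_i)_{i\in I_\beta})$ has as elements of type $i$ the left cosets $bB_i$; two cosets are incident if they intersect. For $J\subseteq I_\beta$, $B_J=\bigcap_{i\in J}B_i$ and $B_\emptyset=B$. Diagonals. Let $X_j=\{\sigma B_j\mid\sigma\in B\}$ (here $j=0$). A $j$-diagonal is an unordered pair $\{F_1,F_2\}$ of distinct elements of $X_j$. Two $j$-diagonals are equivalent if some $b\in B$ maps one to the other (as unordered pairs). The class is $[F_1,F_2]$, and $\mathcal{C}^j_\beta$ is the set of all classes. Diagonal Coxeter graph. $\mathcal{D}(\beta,j,\lambda)$ has vertex set $X_j$; distinct $F_1,F_2$ are joined by an edge iff $\lambda([F_1,F_2])\neq 2$, and the edge is then labelled $\lambda([F_1,F_2])$. $A=W(\mathcal{D})$ is generated by $a_F$ ($F\in X_j$) with defining relations $a_F^2=1$ and $(a_Fa_E)^{\lambda([F,E])}=1$ for $F\ne E$ with $\lambda([F,E])<\infty$. Set $A_F=\langle a_E\mid E\in X_j\setminus\{F\}\rangle$; the standard coset incidence system is $\alpha=(A,(A_F)_{F\in X_j})$. The action $\eta:B\to\operatorname{Aut}(A)$ is given by $\eta(b)(a_F)=a_{bF}$; it satisfies $\eta(b)(A_F)=A_{bF}$, and $B$ has the unique orbit $L=X_j$ on the types of $\alpha$. Twisting (for one orbit $L=X_j$ with representative $F_L=B_j$). $\mathcal{T}(\alpha,\beta)=(G,(G_i)_{i\in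 I_\beta\sqcup\{L\}})$ with $G=A\rtimes_\eta B$, $G_i=A_{L\setminus (B_i\cdot F_L)}\rtimes B_i$ for $i\in I_\beta$, and $G_L=A_L\rtimes B$, where $A_J=\bigcap_{F\in J}A_F$ for $J\subseteq X_j$ and $A_\emptyset=A$. The McMullen–Schulte polytope $2^{\beta,\mathcal{D}}$. It is the abstract regular $(n+1)$-polytope with automorphism group $W(\mathcal{D})\rtimes_\eta B$ and distinguished generators $\tau_0=a_{B_0}$ and $\tau_i=\rho_{i-1}$ for $1\le i\le n$; that is, its $i$-faces are the left cosets of $\langle\tau_k\mid k\ne i\rangle$ ($0\le i\le n$), two faces being incident iff the cosets intersect. The symbol $\cong$ denotes isomorphism of polytopes, regarded as incidence geometries, the type $L$ of $\mathcal{T}(\alpha,\beta)$ corresponding to rank $0$ and the type $i\in\{0,\ldots,n-1\}$ to rank $i+1$. *)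

(* Defs.v *)
From HB Require Import structures.
From mathcomp Require Import all_boot all_order.
From mathcomp Require Import generic_quotient.
From mathcomp Require Import boolp classical_sets functions cardinality.
From Stdlib Require Import Relation_Operators.

Set Implicit Arguments.
Unset Strict Implicit.
Unset Printing Implicit Defensive.

Import Order.TTheory.
Local Open Scope quotient_scope.
Local Open Scope card_scope.
Local Open Scope classical_set_scope.
Local Open Scope group_scope.

Section Subgroups.
Variable G : groupType.

Definition is_subgroup (S : set G) : Prop :=
  [/\ S 1, forall x y, S x -> S y -> S (x * y) & forall x, S x -> S x^-1].

Definition generated (S : set G) : set G := smallest is_subgroup S.

Definition left_cosets (H : set G) : set (set G) :=
  [set C | exists g, C = [set g * h | h in H]].

Lemma left_coset_shift (H : set G) (b : G) (C : left_cosets H) :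
  [set b * x | x in val C] \in left_cosets H.
Proof.
case: C => C /= /[dup] + _ => /set_mem [g ->].
apply/mem_set; exists (b * g); apply/seteqP; split=> x /=.
  by move=> [_ [h Hh <-] <-]; exists h => //; rewrite mulgA.
by move=> [h Hh <-]; exists (g * h); [exists h | rewrite mulgA].
Qed.

(* The left translation action b . (sigma H) = (b sigma) H. *)
Definition coset_act (H : set G) (b : G) (C : left_cosets H) : left_cosets H :=
  SigSub (left_coset_shift b C).

Lemma base_coset_subproof (H : set G) : H \in left_cosets H.
Proof.
apply/mem_set; exists 1; apply/seteqP; split=> x /=.
  by move=> Hx; exists x => //; rewrite mul1g.
by move=> [h Hh <-]; rewrite mul1g.
Qed.

Definition base_coset (H : set G) : left_cosets H :=
  SigSub (base_coset_subproof H).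

Lemma coset_act1 (H : set G) (C : left_cosets H) : coset_act 1 C = C.
Proof.
apply/val_inj/seteqP; split=> x /=.
  by move=> [y Cy <-]; rewrite mul1g.
by move=> Cx; exists x => //; rewrite mul1g.
Qed.

Lemma coset_actM (H : set G) (b c : G) (C : left_cosets H) :
  coset_act (b * c) C = coset_act b (coset_act c C).
Proof.
apply/val_inj/seteqP; split=> x /=.
  by move=> [y Cy <-]; exists (c * y); [exists y | rewrite mulgA].
by move=> [_ [y Cy <-] <-]; exists y => //; rewrite mulgA.
Qed.

Lemma coset_act_inj (H : set G) (b : G) : injective (@coset_act H b).
Proof.
by move=> C D e; rewrite -[C]coset_act1 -[D]coset_act1 -(mulVg b) !coset_actM e.
Qed.

End Subgroups.

Record incidence_system (I : Type) := IncidenceSystem {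
  element : I -> Type;
  incident : forall i j : I, element i -> element j -> Prop
}.

Definition coset_system (G : groupType) (I : Type) (Gs : I -> set G) :
    incidence_system I :=
  {| element := fun i => left_cosets (Gs i);
     incident := fun i j C D => val C `&` val D !=set0 |}.

(* Isomorphism of incidence systems inducing the correspondence t on types. *)
Definition isomorphic_over (I J : Type) (t : I -> J)
    (S : incidence_system I) (T : incidence_system J) : Prop :=
  bijective t /\
  exists phi : forall i, element S i -> element T (t i),
    (forall i, bijective (phi i)) /\
    forall i j (x : element S i) (y : element S j),
      incident x y <-> incident (phi i x) (phi j y).

Section Polytope.
Variables (d : Order.disp_t) (P : tbPOrderType d).
Implicit Types (Phi Psi : set P) (F G H : P).

Definition chain Phi : Prop := total_on Phi (fun F G : P => (F <= G)%O).

Definition flag Phi : Prop :=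
  chain Phi /\ forall Psi, chain Psi -> Phi `<=` Psi -> Psi = Phi.

(* F has rank k - 1: the least face has level 0 and i-faces have level i + 1.
   When all flags have the same finite cardinality, the level does not depend
   on the flag through F. *)
Definition level (k : nat) F : Prop :=
  exists Phi, [/\ flag Phi, Phi F & [set G | Phi G /\ (G < F)%O] #= `I_k].

Definition adjacent Phi Psi : Prop :=
  [/\ flag Phi, flag Psi &
      exists F G, Phi `\` Psi = [set F] /\ Psi `\` Phi = [set G]].

Definition rank_adjacent (i : nat) Phi Psi : Prop :=
  [/\ flag Phi, flag Psi &
      exists F G, [/\ Phi `\` Psi = [set F], Psi `\` Phi = [set G],
                      level i.+1 F & level i.+1 G]].

Definition strongly_flag_connected : Prop :=
  forall Phi Psi, flag Phi -> flag Psi ->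
    clos_refl_trans (set P)
      (fun X Y => [/\ adjacent X Y, Phi `&` Psi `<=` X & Phi `&` Psi `<=` Y])
      Phi Psi.

Definition diamond : Prop :=
  forall k F G, level k F -> level k.+2 G -> (F < G)%O ->
    exists H1 H2, H1 <> H2 /\
      [set H | level k.+1 H /\ (F < H < G)%O] = [set H1; H2].

(* The least and greatest faces come from tbPOrderType; a flag of an n-polytope
   has n + 2 faces, these two included. *)
Definition abstract_polytope (n : nat) : Prop :=
  [/\ forall Phi, flag Phi -> Phi #= `I_n.+2,
      strongly_flag_connected & diamond].

Record order_aut := OrderAut {
  oaut_fun :> P -> P;
  oaut_inv : P -> P;
  oaut_funK : cancel oaut_fun oaut_inv;
  oaut_invK : cancel oaut_inv oaut_fun;
  oaut_mono : {mono oaut_fun : x y / (x <= y)%O}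
}.

Lemma order_aut_eq (f g : order_aut) : f =1 g -> f = g.
Proof.
move=> /funext; case: f g => [f f' fK f'K fm] [g g' gK g'K gm] /= fg.
subst g; have fg' : f' = g' by apply/funext => x; rewrite -{1}(g'K x) fK.
subst g'; congr OrderAut; exact: Prop_irrelevance.
Qed.

HB.instance Definition _ := gen_eqMixin order_aut.
HB.instance Definition _ := gen_choiceMixin order_aut.

Definition order_aut_one : order_aut :=
  @OrderAut id id (fun=> erefl) (fun=> erefl) (fun _ _ => erefl).

Lemma order_aut_mul_mono (f g : order_aut) :
  {mono (f \o g) : x y / (x <= y)%O}.
Proof. by move=> x y /=; rewrite !oaut_mono. Qed.

Definition order_aut_mul (f g : order_aut) : order_aut :=
  OrderAut (can_comp (@oaut_funK f) (@oaut_funK g))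
           (can_comp (@oaut_invK g) (@oaut_invK f)) (order_aut_mul_mono f g).

Lemma order_aut_inv_mono (f : order_aut) : {mono oaut_inv f : x y / (x <= y)%O}.
Proof. by move=> x y; rewrite -(oaut_mono f) !oaut_invK. Qed.

Definition order_aut_inv (f : order_aut) : order_aut :=
  OrderAut (@oaut_invK f) (@oaut_funK f) (order_aut_inv_mono f).

Lemma order_aut_mulA : associative order_aut_mul.
Proof. by move=> f g h; apply: order_aut_eq. Qed.
Lemma order_aut_mul1 : left_id order_aut_one order_aut_mul.
Proof. by move=> f; apply: order_aut_eq. Qed.
Lemma order_aut_mulr1 : right_id order_aut_one order_aut_mul.
Proof. by move=> f; apply: order_aut_eq. Qed.
Lemma order_aut_mulV : left_inverse order_aut_one order_aut_inv order_aut_mul.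
Proof. by move=> f; apply: order_aut_eq => x /=; rewrite oaut_funK. Qed.
Lemma order_aut_mulrV : right_inverse order_aut_one order_aut_inv order_aut_mul.
Proof. by move=> f; apply: order_aut_eq => x /=; rewrite oaut_invK. Qed.

HB.instance Definition _ := isGroup.Build order_aut
  order_aut_mulA order_aut_mul1 order_aut_mulr1 order_aut_mulV order_aut_mulrV.

Definition regular : Prop :=
  forall Phi Psi, flag Phi -> flag Psi ->
    exists g : order_aut, [set g F | F in Phi] = Psi.

Definition distinguished_generators (n : nat) Phi (rho : 'I_n -> order_aut) :
    Prop :=
  forall i : 'I_n, rank_adjacent i Phi [set rho i F | F in Phi].

End Polytope.

Arguments regular {d} P.
Arguments abstract_polytope {d} P n.

Section Presentation.
Variables (X : choiceType) (R : set (seq (X * bool))).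

(* Words in the generators; (x, false) stands for x and (x, true) for x^-1. *)
Local Notation word := (seq (X * bool)).

Definition word_inv (w : word) : word := rev [seq (l.1, ~~ l.2) | l <- w].

(* The least congruence that kills the relators and x x^-1, x^-1 x. *)
Inductive word_eq : word -> word -> Prop :=
| word_eq_refl u : word_eq u u
| word_eq_sym u v : word_eq u v -> word_eq v u
| word_eq_trans u v w : word_eq u v -> word_eq v w -> word_eq u w
| word_eq_cat u v u' v' :
    word_eq u v -> word_eq u' v' -> word_eq (u ++ u') (v ++ v')
| word_eq_free x e : word_eq [:: (x, e); (x, ~~ e)] [::]
| word_eq_relator r : R r -> word_eq r [::].

Definition word_eqb (u v : word) : bool := `[< word_eq u v >].

Lemma word_eqb_refl : reflexive word_eqb.
Proof. by move=> u; apply/asboolP; apply: word_eq_refl. Qed.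
Lemma word_eqb_sym : symmetric word_eqb.
Proof. by move=> u v; apply/asboolP/asboolP; apply: word_eq_sym. Qed.
Lemma word_eqb_trans : transitive word_eqb.
Proof.
by move=> v u w /asboolP uv /asboolP vw; apply/asboolP/(word_eq_trans uv vw).
Qed.

Definition word_equiv : equiv_rel word :=
  EquivRel word_eqb word_eqb_refl word_eqb_sym word_eqb_trans.

Definition presented := {eq_quot word_equiv}.

HB.instance Definition _ := Choice.on presented.

Definition pres_word (w : word) : presented := \pi_({eq_quot word_equiv}) w.
Definition pres_repr (x : presented) : word :=
  repr (x : {eq_quot word_equiv}).

Lemma pres_wordP u v : pres_word u = pres_word v <-> word_eq u v.
Proof.
split=> [uv|uv]; last by apply/eqmodP/asboolP.
by apply/asboolP; have /eqmodP := uv.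
Qed.

Lemma pres_reprK x : pres_word (pres_repr x) = x.
Proof. exact: reprK. Qed.

Lemma pres_repr_word w : word_eq (pres_repr (pres_word w)) w.
Proof. by apply/pres_wordP; rewrite pres_reprK. Qed.

Lemma word_eq_invr w : word_eq (w ++ word_inv w) [::].
Proof.
elim: w => [|[x e] w IH]; first exact: word_eq_refl.
rewrite /word_inv /= rev_cons -cats1 catA.
apply: word_eq_trans (word_eq_free x e).
apply: (@word_eq_cat ([:: (x, e)] ++ (w ++ word_inv w)) [:: (x, e)]
                     [:: (x, ~~ e)]); last exact: word_eq_refl.
by apply: (@word_eq_cat _ [:: (x, e)] _ [::]) => //; apply: word_eq_refl.
Qed.

Lemma word_invK : involutive word_inv.
Proof.
move=> w; rewrite /word_inv map_rev revK -map_comp -[RHS]map_id.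
by apply: eq_map => -[x e] /=; rewrite negbK.
Qed.

Lemma word_eq_invl w : word_eq (word_inv w ++ w) [::].
Proof. by rewrite -{2}[w]word_invK; apply: word_eq_invr. Qed.

Definition pres_mul (x y : presented) := pres_word (pres_repr x ++ pres_repr y).
Definition pres_inv (x : presented) := pres_word (word_inv (pres_repr x)).
Definition pres_one : presented := pres_word [::].

Lemma pres_mulE u v : pres_mul (pres_word u) (pres_word v) = pres_word (u ++ v).
Proof. by apply/pres_wordP/word_eq_cat; apply: pres_repr_word. Qed.

Lemma pres_mulA : associative pres_mul.
Proof.
move=> x y z; rewrite -(pres_reprK x) -(pres_reprK y) -(pres_reprK z).
by rewrite !pres_mulE catA.
Qed.
Lemma pres_mul1 : left_id pres_one pres_mul.
Proof. by move=> x; rewrite -(pres_reprK x) pres_mulE. Qed.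
Lemma pres_mulr1 : right_id pres_one pres_mul.
Proof. by move=> x; rewrite -(pres_reprK x) pres_mulE cats0. Qed.
Lemma pres_mulV : left_inverse pres_one pres_inv pres_mul.
Proof.
move=> x; rewrite -{2}(pres_reprK x) pres_mulE.
exact/pres_wordP/word_eq_invl.
Qed.
Lemma pres_mulrV : right_inverse pres_one pres_inv pres_mul.
Proof.
move=> x; rewrite -{1}(pres_reprK x) pres_mulE.
exact/pres_wordP/word_eq_invr.
Qed.

HB.instance Definition _ := isGroup.Build presented
  pres_mulA pres_mul1 pres_mulr1 pres_mulV pres_mulrV.

Definition pres_gen (x : X) : presented := pres_word [:: (x, false)].

Section Lift.
Variables (H : groupType) (f : X -> H).

Definition word_eval (w : word) : H :=
  \prod_(l <- w) (if l.2 then (f l.1)^-1 else f l.1).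

Lemma word_eval_eq u v : (forall r, R r -> word_eval r = 1) ->
  word_eq u v -> word_eval u = word_eval v.
Proof.
move=> fR; elim=> {u v} //.
- by move=> u v w _ -> _ ->.
- by move=> u v u' v' _ e _ e'; rewrite /word_eval !big_cat /= -/(word_eval _)
    -/(word_eval u') e e'.
- move=> x e; rewrite /word_eval !big_cons big_nil mulg1 /=.
  by case: e; rewrite ?mulVg ?mulgV.
- by move=> r /fR ->; rewrite /word_eval big_nil.
Qed.

(* The homomorphism extending f when f kills the relators. *)
Definition pres_lift (x : presented) : H := word_eval (pres_repr x).

Hypothesis fR : forall r, R r -> word_eval r = 1.

Lemma pres_lift_word w : pres_lift (pres_word w) = word_eval w.
Proof. exact/word_eval_eq/pres_repr_word. Qed.

Lemma pres_lift_gen x : pres_lift (pres_gen x) = f x.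
Proof. by rewrite pres_lift_word /word_eval big_seq1. Qed.

Lemma pres_liftM x y : pres_lift (x * y) = pres_lift x * pres_lift y.
Proof.
rewrite -(pres_reprK x) -(pres_reprK y) [_ * _ in LHS]pres_mulE !pres_lift_word.
by rewrite /word_eval big_cat.
Qed.

End Lift.

Lemma word_eval_gen w : word_eval pres_gen w = pres_word w.
Proof.
rewrite /word_eval; elim: w => [|[x e] w IH]; first by rewrite big_nil.
rewrite big_cons IH /= -cat1s -pres_mulE; congr (_ * _).
case: e => //; apply/(@mulgI _ (pres_gen x)); rewrite mulgV.
by rewrite [_ * _ in RHS]pres_mulE; apply/esym/pres_wordP/word_eq_free.
Qed.

Lemma pres_hom_eq (H : groupType) (g h : presented -> H) :
    {morph g : x y / x * y} -> {morph h : x y / x * y} ->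
  (forall x, g (pres_gen x) = h (pres_gen x)) -> g =1 h.
Proof.
move=> gM hM gh x; rewrite -(pres_reprK x) -word_eval_gen /word_eval.
have h1 (k : presented -> H) : {morph k : x y / x * y} -> k 1 = 1.
  by move=> kM; apply/(@mulgI _ (k 1)); rewrite -kM !mulg1.
have hV (k : presented -> H) y : {morph k : x y / x * y} -> k y^-1 = (k y)^-1.
  by move=> kM; apply/(@mulgI _ (k y)); rewrite -kM !mulgV h1.
elim: (pres_repr x) => [|[y e] w IH]; first by rewrite !big_nil !h1.
by rewrite !big_cons gM hM IH; case: e; rewrite /= ?hV ?gh.
Qed.

End Presentation.

(* A homomorphism B -> Aut(A), as an action of B on A by automorphisms. *)
Record aut_action (B A : groupType) := AutAction {
  act_fun :> B -> A -> A;
  act_fun1 : forall x, act_fun 1 x = x;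
  act_funM : forall b c x, act_fun (b * c) x = act_fun b (act_fun c x);
  act_morph : forall b, {morph act_fun b : x y / x * y}
}.

Definition sdprod (B A : groupType) (eta : aut_action B A) : Type :=
  (A * B)%type.

Section SemidirectProduct.
Variables (B A : groupType) (eta : aut_action B A).
Local Notation sdprod := (sdprod eta).

HB.instance Definition _ := Choice.copy sdprod (A * B)%type.

Definition sd_one : sdprod := (1, 1).
Definition sd_mul (x y : sdprod) : sdprod := (x.1 * eta x.2 y.1, x.2 * y.2).
Definition sd_inv (x : sdprod) : sdprod := (eta x.2^-1 x.1^-1, x.2^-1).

Lemma sd_act1 b : eta b 1 = 1.
Proof. by apply/(@mulgI _ (eta b 1)); rewrite -act_morph !mulg1. Qed.

Lemma sd_mulA : associative sd_mul.
Proof.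
by move=> x y z; rewrite /sd_mul /= act_morph act_funM !mulgA.
Qed.
Lemma sd_mul1 : left_id sd_one sd_mul.
Proof. by move=> [a b]; rewrite /sd_mul /= act_fun1 !mul1g. Qed.
Lemma sd_mulr1 : right_id sd_one sd_mul.
Proof. by move=> [a b]; rewrite /sd_mul /= sd_act1 !mulg1. Qed.
Lemma sd_mulV : left_inverse sd_one sd_inv sd_mul.
Proof.
by move=> [a b]; rewrite /sd_mul /sd_inv /= -act_morph !mulVg sd_act1.
Qed.
Lemma sd_mulrV : right_inverse sd_one sd_inv sd_mul.
Proof.
by move=> [a b]; rewrite /sd_mul /sd_inv /= -act_funM mulgV act_fun1 mulgV.
Qed.

HB.instance Definition _ := isGroup.Build sdprod
  sd_mulA sd_mul1 sd_mulr1 sd_mulV sd_mulrV.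

Definition sd_sub (S : set A) (T : set B) : set sdprod :=
  [set x | S x.1 /\ T x.2].

End SemidirectProduct.

(* Labels in {2, 3, ...} together with infinity. *)
Variant label := FiniteLabel (m : nat) of 1 < m | InfiniteLabel.

(* The label 2 means that there is no edge between F and E. *)
Definition coxeter_graph (V : Type) := forall F E : V, F <> E -> label.

Section CoxeterGroup.
Variables (V : choiceType) (D : coxeter_graph V).

Definition coxeter_relators : set (seq (V * bool)) :=
  [set w | (exists F, w = [:: (F, false); (F, false)]) \/
     exists F E (FE : F <> E) m (m_gt1 : 1 < m),
       D FE = FiniteLabel m_gt1 /\
       w = flatten (nseq m [:: (F, false); (E, false)])].

Definition coxeter_group : groupType := presented coxeter_relators.

Definition coxeter_gen (F : V) : coxeter_group := pres_gen _ F.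

(* The maximal parabolic subgroups A_F of the standard coset incidence system. *)
Definition coxeter_parabolic (F : V) : set coxeter_group :=
  generated [set coxeter_gen E | E in [set E | E <> F]].

End CoxeterGroup.

Arguments coxeter_parabolic {V} D F.

Section Diagonals.
Variables (B : groupType) (H : set B).
Local Notation X := (set_type (left_cosets H)).

Definition diagonals : set (set X) :=
  [set D | exists F E : X, F <> E /\ D = [set F; E]].

Definition diagonal_class (D : set X) : set (set X) :=
  [set D' | exists b, D' = [set coset_act b F | F in D]].

Definition diagonal_classes : set (set (set X)) :=
  [set diagonal_class D | D in diagonals].

Lemma diag_class_subproof (F E : X) :
  F <> E -> diagonal_class [set F; E] \in diagonal_classes.
Proof. by move=> FE; apply/mem_set; exists [set F; E] => //; exists F, E. Qed.

Definition diag_class (F E : X) (FE : F <> E) : diagonal_classes :=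
  SigSub (diag_class_subproof FE).

Definition diagonal_graph (lambda : diagonal_classes -> label) :
  coxeter_graph X := fun F E FE => lambda (diag_class FE).

Variable lambda : diagonal_classes -> label.

Local Notation D := (diagonal_graph lambda).
Local Notation A := (coxeter_group D).

Lemma diag_class_act (b : B) (F E : X) (FE : F <> E)
    (bFE : coset_act b F <> coset_act b E) : diag_class bFE = diag_class FE.
Proof.
apply/val_inj => /=; apply/seteqP; split=> S /= [c ->].
  by exists (c * b); rewrite !image_setU !image_set1 !coset_actM.
exists (c * b^-1); rewrite !image_setU !image_set1.
by rewrite -!coset_actM -!mulgA !mulVg !mulg1.
Qed.

Lemma diagonal_act_relator (b : B) r : coxeter_relators D r ->
  word_eval (fun F => coxeter_gen D (coset_act b F)) r = 1.
Proof.
have eval_map w : word_eval (fun F => coxeter_gen D (coset_act b F)) w =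
    pres_word (coxeter_relators D) [seq (coset_act b l.1, l.2) | l <- w].
  by rewrite -word_eval_gen /word_eval big_map.
move=> Rr; rewrite eval_map; apply/pres_wordP/word_eq_relator.
case: Rr => [[F ->]|[F [E [FE [m [m1 [DFE ->]]]]]]] /=.
  by left; exists (coset_act b F).
have bFE : coset_act b F <> coset_act b E by move=> /coset_act_inj.
right; exists (coset_act b F), (coset_act b E), bFE, m, m1; split.
  by rewrite -DFE /diagonal_graph (diag_class_act FE).
by rewrite map_flatten map_nseq.
Qed.

(* eta(b) is the automorphism of W(D) with a_F |-> a_(b F). *)
Definition diagonal_act (b : B) : A -> A :=
  pres_lift (fun F => coxeter_gen D (coset_act b F)).

Lemma diagonal_act_gen b F :
  diagonal_act b (coxeter_gen D F) = coxeter_gen D (coset_act b F).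
Proof. exact/pres_lift_gen/diagonal_act_relator. Qed.

Lemma diagonal_act_morph b : {morph diagonal_act b : x y / x * y}.
Proof. exact/pres_liftM/diagonal_act_relator. Qed.

Lemma diagonal_act1 x : diagonal_act 1 x = x.
Proof.
apply: (pres_hom_eq (g := diagonal_act 1) (h := id)) => // [|F].
  exact: diagonal_act_morph.
by rewrite [LHS]diagonal_act_gen coset_act1.
Qed.

Lemma diagonal_actM b c x :
  diagonal_act (b * c) x = diagonal_act b (diagonal_act c x).
Proof.
apply: (pres_hom_eq (g := diagonal_act (b * c))
         (h := diagonal_act b \o diagonal_act c)) => [||F].
- exact: diagonal_act_morph.
- by move=> y z /=; rewrite !diagonal_act_morph.
- rewrite [LHS](diagonal_act_gen (b * c)) coset_actM -!diagonal_act_gen.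
  by [].
Qed.

Definition diagonal_action : aut_action B A :=
  AutAction diagonal_act1 diagonal_actM diagonal_act_morph.

End Diagonals.

Arguments diagonal_classes {B} H.

Section Twisting.
Variables (A B : groupType) (eta : aut_action B A).
Variables (L : Type) (As : L -> set A) (actL : B -> L -> L) (FL : L).
Variables (I : Type) (Bs : I -> set B).

(* The type L adjoined to the types I of beta is None. *)
Definition twisting_subgroup (t : option I) : set (sdprod eta) :=
  match t with
  | Some i => sd_sub (\bigcap_(F in ~` [set actL b FL | b in Bs i]) As F) (Bs i)
  | None => sd_sub (\bigcap_(F in [set: L]) As F) [set: B]
  end.

Definition twisting : incidence_system (option I) :=
  coset_system twisting_subgroup.

End Twisting.

Section MaximalParabolics.
Variables (G : groupType) (n : nat) (rho : 'I_n -> G).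

Definition maximal_parabolic (i : 'I_n) : set G :=
  generated [set rho k | k in [set k | k <> i]].

End MaximalParabolics.

Section TwoPowerPolytope.
Variables (B : groupType) (n : nat) (rho : 'I_n -> B) (i0 : 'I_n).
Local Notation B0 := (maximal_parabolic rho i0).
Variable lambda : diagonal_classes B0 -> label.

(* unlift ord0 sends rank 0 to None and rank i + 1 to Some i. *)
Definition two_power_generator (k : 'I_n.+1) :
    sdprod (diagonal_action lambda) :=
  match unlift ord0 k with
  | None => (coxeter_gen (diagonal_graph lambda) (base_coset B0), 1)
  | Some i => (1, rho i)
  end.

Definition two_power_polytope : incidence_system 'I_n.+1 :=
  coset_system (maximal_parabolic two_power_generator).

(* T(alpha, beta) for the standard coset incidence system alpha of W(D). *)
Definition diagonal_twisting : incidence_system (option 'I_n) :=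
  twisting (diagonal_action lambda) (coxeter_parabolic (diagonal_graph lambda))
    (@coset_act B B0) (base_coset B0) (maximal_parabolic rho).

End TwoPowerPolytope.

Arguments two_power_polytope {B n} rho i0 lambda.
Arguments diagonal_twisting {B n} rho i0 lambda.

(* Main.v *)
Require Import Defs.
From mathcomp Require Import all_boot all_order.
From mathcomp Require Import boolp classical_sets functions cardinality.
From mathcomp Require Import ssralg ssrnum poly algC cyclotomic ring.

(** Both incidence systems are coset systems of the same group
W(D) ><| B, so it suffices that their maximal parabolic subgroups agree, type
by type; cosets and incidence are then literally the same
([coset_system_isomorphic]). With F0 the base vertex, X the set of all vertices
and A_J the intersection of the A_F, F in J, this compares, for a type i of
beta and for the adjoined type L,

  <a_F0, rho_j | j <> i>   with   (A_(X \ B_i F0)) ><| B_i,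
  <rho_j | all j>          with   A_X ><| B.

The left sides are computed by a fact about any semidirect product
([generated_sdprod]): elements a of the normal factor together with elements
generating a subgroup T of the acting one generate N ><| T, where N is
generated by the T-conjugates of the a. Here N is generated by the a_F with F
in the orbit B_i F0, respectively N is trivial. It remains to see that

- an intersection of the A_F, F in J, is generated by the a_E with E not in J
  ([bigcap_coxeter_parabolic]); this identifies the normal factors;
- the distinguished generators generate the whole automorphism group of the
  polytope ([distinguished_generate]); this identifies the factor B of type L.

The first fact is the classical theorem on parabolic subgroups of a Coxeter
group. A word s_1 ... s_k has the reflections
t_i = s_1 ... s_(i-1) s_i s_(i-1) ... s_1, and the parity with which a given
element occurs among them depends only on the element of W that the word
represents ([odd_reflections]). In a reduced word the reflections are distinct
because a repetition allows two letters to be deleted, so each of them also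
occurs among the reflections of any other word for the same element. If some
such word has its letters in J, then all t_i, hence all letters s_i, lie in
the subgroup W_J; so a reduced word of an element of W_J only has letters in J,
provided that a_F in W_J forces F in J. This last point needs that distinct
vertices give distinct generators, and that is the only place where a
representation of W enters ([coxeter_gen_inj]).

The second fact: all flags have the same finite length, so a face has the same
position in every flag containing it, and the diamond condition says that a
flag has only one neighbour differing from it in a given position. Hence the
rho_i Phi are all the flags adjacent to Phi; by connectedness <rho> is
transitive on the flags, and an automorphism fixing a flag is trivial. *)

Set Implicit Arguments.
Unset Strict Implicit.
Unset Printing Implicit Defensive.
Local Open Scope classical_set_scope.

(** * Generated subgroups *)

Section Generated.
Local Open Scope group_scope.
Variable G : groupType.
Implicit Types S T : set G.

Lemma generated_subgroup S : is_subgroup (generated S).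
Proof.
split.
- by move=> H [[]].
- move=> x y Sx Sy H HS; have [[_ HM _] _] := HS.
  exact: HM (Sx H HS) (Sy H HS).
- move=> x Sx H HS; have [[_ _ HV] _] := HS; exact: HV (Sx H HS).
Qed.

Lemma generated1 S : generated S 1.
Proof. by have [] := generated_subgroup S. Qed.

Lemma generatedM S x y : generated S x -> generated S y -> generated S (x * y).
Proof. by have [_ + _] := generated_subgroup S; apply. Qed.

Lemma generatedV S x : generated S x -> generated S x^-1.
Proof. by have [_ _] := generated_subgroup S; apply. Qed.

Lemma sub_generated S : S `<=` generated S.
Proof. exact: sub_smallest. Qed.

Lemma generated_sub S T : is_subgroup T -> S `<=` T -> generated S `<=` T.
Proof. by move=> ? ?; apply: smallest_sub. Qed.

Lemma generatedS S T : S `<=` T -> generated S `<=` generated T.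
Proof.
move=> ST; apply: generated_sub; first exact: generated_subgroup.
exact: subset_trans ST (@sub_generated T).
Qed.

End Generated.

(** * Distinct vertices of a Coxeter graph give distinct generators *)

Section NumbersGame.
Import GRing.Theory.
Local Open Scope ring_scope.
Variables (V : Type) (K : fieldType) (k : V -> V -> K).

(** The contragredient of the geometric representation of a Coxeter group, on
arbitrary functions on the vertices, so that an infinite graph causes no
trouble; known as a move of Mozes's numbers game. *)
Definition fire (s : V) (f : V -> K) : V -> K := fun t => f t + k s t * f s.

Lemma fireK s : k s s = -2 -> involutive (fire s).
Proof. by move=> kss f; apply/funext => t; rewrite /fire kss; ring. Qed.

(** With c = z + 1/z, the product of two moves acts on the pair (f s, f t) by
a matrix of trace c^2 - 2 = z^2 + z^-2 and determinant 1, hence with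
eigenvalues z^2 and z^-2, which are m-th roots of unity. At any other vertex,
f changes by combinations of two geometric progressions with these ratios,
and the sums over a full period vanish since the ratios are not 1. *)
Lemma fire_order (s t : V) (z : K) (m : nat) :
    k s s = -2 -> k t t = -2 -> k s t = z + z^-1 -> k t s = z + z^-1 ->
    z ^+ 2 != 1 -> z ^+ (2 * m) = 1 -> (0 < m)%N ->
  iter m (fire s \o fire t) =1 id.
Proof.
move=> kss ktt kst kts z2 zm m_gt0 f; apply/funext => u.
have z0 : z != 0.
  apply/eqP => z0; move: zm; rewrite z0 expr0n.
  by case: m m_gt0 => // m _ /esym/eqP; rewrite oner_eq0.
have z21 : z ^+ 2 - 1 != 0 by rewrite subr_eq0.
(* Eigenfunctionals for the eigenvalues z^2 and z^-2. *)
pose lp (g : V -> K) := g t + z^-1 * g s.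
pose lm (g : V -> K) := g t + z * g s.
have lpE g : lp (fire s (fire t g)) = z ^+ 2 * lp g.
  by rewrite /lp /fire kss ktt kst kts; field.
have lmE g : lm (fire s (fire t g)) = z ^- 2 * lm g.
  by rewrite /lm /fire kss ktt kst kts; field.
(* One round changes the value at u by p * lp + q * lm. *)
pose a := k t u + k s u * (z + z^-1).
pose p := (z * a - k s u) / (z - z^-1).
pose q := (k s u - z^-1 * a) / (z - z^-1).
(* Subtracting the closed forms of the geometric sums gives an invariant. *)
pose I (g : V -> K) :=
  g u - p * lp g / (z ^+ 2 - 1) - q * lm g / (z ^- 2 - 1).
have IE g : I (fire s (fire t g)) = I g.
  rewrite /I lpE lmE /fire kts /p /q /a /lp /lm; field.
  by rewrite z0 mulN1r -expr2 z21 -[1 - _]opprB oppr_eq0 z21.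
have iterE n : [/\ I (iter n (fire s \o fire t) f) = I f,
    lp (iter n (fire s \o fire t) f) = z ^+ (2 * n) * lp f &
    lm (iter n (fire s \o fire t) f) = z ^- (2 * n) * lm f].
  elim: n => [|n [IH1 IH2 IH3]]; first by rewrite muln0 expr0 invr1 !mul1r.
  rewrite iterS /= IE IH1 lpE lmE IH2 IH3 mulnS exprD; split=> //.
    by rewrite mulrA.
  by rewrite mulrA -invfM.
have [] := iterE m.
rewrite /I zm invr1 !mul1r => + e1 e2; rewrite e1 e2.
by move=> e; apply/(addIr _ (addIr _ e)).
Qed.

End NumbersGame.

Section CoxeterGenerators.
Import GRing.Theory Num.Theory.
Local Open Scope ring_scope.
Variables (V : choiceType) (D : coxeter_graph V).
Hypothesis D_sym : forall F E (FE : F <> E) (EF : E <> F), D FE = D EF.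

(** The group acts by the moves of the numbers game with weights
z + 1/z, for z a primitive 2m-th root of unity, on the edges labelled m. The
generator of F negates the value at F of the indicator function of F, while
every other generator leaves that value unchanged. *)
Lemma coxeter_gen_inj : injective (coxeter_gen D).
Proof.
have /choice [z zP] (m : nat) : exists z : algC,
    (1 < m)%N -> z ^+ (2 * m) = 1 /\ z ^+ 2 != 1.
  have [m_gt1|] := boolP (1 < m)%N; last by exists 0.
  have m2_gt0 : (0 < 2 * m)%N by rewrite muln_gt0 /= ltnW.
  have [z z_prim] := C_prim_root_exists m2_gt0; exists z => _.
  rewrite (prim_expr_order z_prim) -(prim_order_dvd z_prim); split=> //.
  apply/negP => /(dvdn_leq (ltn0Sn 1)).
  by rewrite -[X in (_ <= X)%N]muln1 leq_pmul2l // leqNgt m_gt1.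
(* Any weight would do on the edges labelled infinity. *)
pose k (s t : V) : algC := match pselect (s = t) with
  | left _ => -2
  | right st => if D st is FiniteLabel m _ then z m + (z m)^-1 else 0
  end.
have kss s : k s s = -2 by rewrite /k; case: pselect.
have kst s t (st : s <> t) m (m_gt1 : (1 < m)%N) :
    D st = FiniteLabel m_gt1 -> k s t = z m + (z m)^-1.
  rewrite /k; case: pselect => // st' Dst.
  by rewrite (Prop_irrelevance st' st) Dst.
pose game (w : seq (V * bool)) (f : V -> algC) :=
  foldr (fun l => fire k l.1) f w.
have game_eq u v : word_eq (coxeter_relators D) u v -> game u =1 game v.
  elim=> {u v} //.
  - by move=> u v _ uv f; rewrite uv.
  - by move=> u v w _ uv _ vw f; rewrite uv.
  - move=> u v u' v' _ uv _ uv' f.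
    by rewrite /game !foldr_cat -!/(game _ _) uv' uv.
  - by move=> x e f; rewrite /game /= fireK.
  - move=> r [[F ->]|[F [E [FE [m [m_gt1 [DFE ->]]]]]]] f.
      by rewrite /game /= fireK.
    have EF : E <> F by move/esym.
    have [zm z2] := zP m m_gt1.
    rewrite /game; transitivity (iter m (fire k F \o fire k E) f).
      by elim: (m) => [|j IH] //=; rewrite IH.
    apply: (fire_order (z := z m)) => //; first exact: kst DFE.
      by apply: kst; rewrite -(D_sym FE).
    exact: ltnW.
move=> F E /pres_wordP/game_eq/(_ (fun t => (t == F)%:R))/(congr1 (@^~ F)).
rewrite /game /= /fire eqxx kss.
have [->//|EF] := eqVneq E F; rewrite mulr0 addr0 mulr1 => /eqP.
by rewrite -subr_eq0 addrAC subrr add0r oppr_eq0 pnatr_eq0.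
Qed.

End CoxeterGenerators.

(** * Intersections of parabolic subgroups of a Coxeter group *)

Section Reflections.
Local Open Scope group_scope.
Variables (V : choiceType) (D : coxeter_graph V).
Local Notation A := (coxeter_group D).
Local Notation a := (coxeter_gen D).
Local Notation word := (seq (V * bool)).
Local Notation pw := (pres_word (coxeter_relators D)).
Implicit Types (J : set V) (u v w : word) (t : A).

Lemma coxeter_gen_invol F : a F * a F = 1.
Proof.
by rewrite [LHS]pres_mulE; apply/pres_wordP/word_eq_relator; left; exists F.
Qed.

Lemma coxeter_genV F : (a F)^-1 = a F.
Proof. by apply: (mulgI (a F)); rewrite mulgV coxeter_gen_invol. Qed.

Lemma pres_word_cons l w : pw (l :: w) = a l.1 * pw w.
Proof.
rewrite -!word_eval_gen /word_eval big_cons; congr (_ * _).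
by case: ifP => // _; apply: coxeter_genV.
Qed.

Lemma pres_word_cat u v : pw (u ++ v) = pw u * pw v.
Proof. by rewrite -!word_eval_gen /word_eval big_cat. Qed.

(** The reflections s_1 ... s_(i-1) s_i s_(i-1) ... s_1 of a word s_1 ... s_k.
The exponents of the letters are ignored because generators are involutions. *)
Fixpoint reflections w : seq A :=
  if w is l :: w' then a l.1 :: [seq t ^ a l.1 | t <- reflections w'] else [::].

Lemma reflections_cat u v :
  reflections (u ++ v) =
  reflections u ++ [seq t ^ (pw u)^-1 | t <- reflections v].
Proof.
elim: u => [|l u IH] /=.
  rewrite -[LHS]map_id; apply: eq_map => t.
  by rewrite [pw [::]]/(1 : A) invg1 conjg1.
rewrite IH map_cat -map_comp; congr (_ :: _ ++ _); apply: eq_map => t /=.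
by rewrite pres_word_cons invgM conjgM coxeter_genV.
Qed.

Lemma count_conj t g (s : seq A) :
  count_mem t [seq x ^ g | x <- s] = count_mem (t ^ g^-1) s.
Proof.
by rewrite count_map; apply: eq_count => x /=; apply/eqP/eqP => [<-|->];
  rewrite -conjgM ?mulgV ?mulVg conjg1.
Qed.

(** Parities behave well under concatenation by [reflections_cat]. For the
relator (a_F a_E)^m with r = a_F a_E, the 2m reflections are the r^i a_F,
i < 2m, and r^m = 1 makes the second half a copy of the first. *)
Lemma odd_reflections u v : word_eq (coxeter_relators D) u v ->
  forall t, odd (count_mem t (reflections u)) =
            odd (count_mem t (reflections v)).
Proof.
elim=> {u v} //.
- by move=> u v w _ uv _ vw t; rewrite uv.
- move=> u v u' v' /pres_wordP uv IH _ IH' t.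
  by rewrite !reflections_cat !count_cat !oddD IH !count_conj uv IH'.
- move=> F e t /=.
  by rewrite /conjg coxeter_genV coxeter_gen_invol mulg1; case: eqP.
- move=> _ [[F ->]|[F [E [FE [m [m_gt1 [DFE ->]]]]]]] t.
    by rewrite /= /conjg coxeter_genV coxeter_gen_invol mulg1; case: eqP.
  set r := a F * a E.
  have rm : r ^+ m = 1.
    have: pw (flatten (nseq m [:: (F, false); (E, false)])) = 1.
      by apply/pres_wordP/word_eq_relator; right; exists F, E, FE, m, m_gt1.
    move=> <-; elim: (m) => [|j IH] //=.
    by rewrite expgS IH !pres_word_cons /= mulgA.
  have reflE j : reflections (flatten (nseq j [:: (F, false); (E, false)])) =
      [seq r ^+ i * a F | i <- iota 0 (j + j)].
    elim: j => [|j IH] //=; rewrite IH addnS /= expg0 mul1g expg1.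
    rewrite /conjg coxeter_genV mulgA; congr [:: _, _ & _].
    rewrite -!map_comp (iotaDl 2 0) -map_comp; apply: eq_map => i /=.
    rewrite /conjg !coxeter_genV; transitivity (r * (r ^+ i * r) * a F).
      by rewrite /r !mulgA.
    by rewrite -expgSr.
  rewrite reflE iotaD map_cat count_cat oddD add0n.
  rewrite -{2}[m]addn0 iotaDl -map_comp.
  rewrite (_ : [seq _ | i <- _] = [seq r ^+ i * a F | i <- iota 0 m]) ?addbb //.
  by apply: eq_map => i /=; rewrite expgnDr rm mul1g.
Qed.

Definition letters_in J w := forall l, l \in w -> J l.1.

Lemma letters_in_cat J u v :
  letters_in J u -> letters_in J v -> letters_in J (u ++ v).
Proof. by move=> Ju Jv l; rewrite mem_cat => /orP[/Ju|/Jv]. Qed.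

Lemma letters_in_subseq J u v : subseq u v -> letters_in J v -> letters_in J u.
Proof. by move=> /mem_subseq uv Jv l /uv/Jv. Qed.

Local Notation parabolic J := (generated [set a E | E in J]).

Lemma parabolic_gen J F : J F -> parabolic J (a F).
Proof. by move=> JF; apply: sub_generated; exists F. Qed.

Lemma parabolic_word J w : letters_in J w -> parabolic J (pw w).
Proof.
elim: w => [|l w IH] Jlw; first exact: generated1.
rewrite pres_word_cons; apply: generatedM.
  by apply: parabolic_gen; apply: Jlw; apply: mem_head.
by refine (IH _) => k kw; apply: Jlw; rewrite inE kw orbT.
Qed.

Lemma parabolicP J x :
  parabolic J x -> exists2 w, letters_in J w & pw w = x.
Proof.
apply: (generated_sub (T := [set x | exists2 w, letters_in J w & pw w = x])).
  split.
  - by exists [::].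
  - move=> _ _ [u Ju <-] [v Jv <-]; exists (u ++ v).
      exact: letters_in_cat.
    exact: pres_word_cat.
  - move=> _ [u Ju <-]; exists (word_inv u).
      by move=> l; rewrite mem_rev => /mapP [k /Ju Jk ->].
    apply: (mulgI (pw u)); rewrite mulgV -pres_word_cat.
    exact/pres_wordP/word_eq_invr.
move=> _ [F JF <-]; exists [:: (F, false)] => //.
by move=> l; rewrite inE => /eqP ->.
Qed.

(** Multiplying by the i-th reflection deletes the i-th letter. *)
Lemma reflection_deletion w t : t \in reflections w ->
  exists u, [/\ subseq u w, size u < size w & pw u = t * pw w].
Proof.
elim: w t => [|l w IH] t //=; rewrite inE => /orP[/eqP ->|/mapP [s /IH]].
  exists w; split=> //; first exact: subseq_cons.
  by rewrite pres_word_cons mulgA coxeter_gen_invol mul1g.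
move=> [u [uw su pu] ->]; exists (l :: u); split=> //=; first by rewrite eqxx.
rewrite !pres_word_cons pu /conjg coxeter_genV -!mulgA.
by rewrite (mulgA (a l.1) (a l.1)) coxeter_gen_invol mul1g.
Qed.

(** If t_i = t_j with i < j, multiplying by t_i t_j = 1 deletes the letters i
and j. *)
Lemma non_reduced_deletion w : ~~ uniq (reflections w) ->
  exists u, [/\ subseq u w, size u < size w & pw u = pw w].
Proof.
elim: w => [|l w IH] //=.
rewrite (map_inj_uniq (conjg_inj _)) negb_and negbK => /orP[|/IH].
  move=> /mapP [t /[swap] /(canLR (conjgK _)) <-].
  rewrite /conjg invgK mulgV mulg1 => /reflection_deletion [u [uw su pu]].
  exists u; split; first exact: subseq_trans (subseq_cons _ _).
    exact: ltnW.
  by rewrite pu pres_word_cons.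
move=> [u [uw su pu]]; exists (l :: u); split=> //=; first by rewrite eqxx.
by rewrite !pres_word_cons pu.
Qed.

(** Distinctness of the reflections serves as the definition of a reduced word
here, so no length function is needed; that the reduced word is a subword keeps
its letters in a given set. *)
Lemma reduced_subword w :
  exists u, [/\ subseq u w, uniq (reflections u) & pw u = pw w].
Proof.
have [n] := ubnP (size w); elim: n w => // n IH w; rewrite ltnS => wn.
have [|/non_reduced_deletion [u [uw su pu]]] := boolP (uniq (reflections w)).
  by exists w.
have [v [vu v_uniq pv]] := IH u (leq_trans su wn).
by exists v; rewrite (subseq_trans vu uw) pv.
Qed.

(** A reflection of a reduced word occurs once, so oddly often, in it. *)
Lemma reflections_sub u v : uniq (reflections u) -> pw u = pw v ->
  {subset reflections u <= reflections v}.
Proof.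
move=> u_uniq /pres_wordP/odd_reflections uv t tu.
have := uv t; rewrite (count_uniq_mem _ u_uniq) tu /=.
by rewrite -has_pred1 has_count; case: count.
Qed.

Lemma parabolic_reflections J w t :
  letters_in J w -> t \in reflections w -> parabolic J t.
Proof.
elim: w t => [|l w IH] t //= Jlw.
have Jl : parabolic J (a l.1).
  by apply: parabolic_gen; apply: Jlw; apply: mem_head.
rewrite inE => /orP[/eqP -> //|/mapP [s sw ->]].
apply: generatedM; first exact: generatedV.
refine (generatedM (IH _ _ sw) Jl) => k kw.
by apply: Jlw; rewrite inE kw orbT.
Qed.

Hypothesis a_inj : injective a.

(** A reduced word of a_F with letters in J has a_F as its only reflection, as
the one-letter word does; its first letter is the first of its reflections. *)
Lemma parabolic_gen_mem J F : parabolic J (a F) -> J F.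
Proof.
move=> /parabolicP [v Jv pv]; have [u [uv u_uniq pu]] := reduced_subword v.
have := reflections_sub (v := [:: (F, false)]) u_uniq.
rewrite pu pv => /(_ erefl).
case: u uv pu {u_uniq} => [|l u] uv pu.
  have := reflections_sub (u := [:: (F, false)]) isT (esym (etrans pu pv)).
  by move=> /(_ _ (mem_head _ _)).
move=> /(_ _ (mem_head _ _)) /=; rewrite inE => /eqP /a_inj <-.
by apply: (letters_in_subseq uv Jv); apply: mem_head.
Qed.

(** All reflections of the word lie in W_J, being reflections of a word with
letters in J; since the i-th one is s_1 ... s_(i-1) s_i (s_1 ... s_(i-1))^-1,
the letters lie in W_J one after the other. *)
Lemma parabolic_reduced J w :
  uniq (reflections w) -> parabolic J (pw w) -> letters_in J w.
Proof.
move=> w_uniq /parabolicP [v Jv pv].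
have: forall t, t \in reflections w -> parabolic J t.
  by move=> t /(reflections_sub w_uniq (esym pv)); apply: parabolic_reflections.
elim: w {w_uniq pv} => [|l w IH] //= Jlw.
have Jl : parabolic J (a l.1) := Jlw _ (mem_head _ _).
move=> k; rewrite inE => /orP[/eqP ->|]; first exact: parabolic_gen_mem.
apply: IH => t tw; rewrite -(conjgK (a l.1) t) [_ ^ _^-1]conjgE invgK.
apply: generatedM => //; apply: generatedM; last exact: generatedV.
by refine (Jlw _ _); rewrite inE; apply/orP; right; apply/mapP; exists t.
Qed.

(** A reduced word of an element of all the A_F avoids every F in J. *)
Lemma bigcap_coxeter_parabolic J :
  \bigcap_(F in J) coxeter_parabolic D F = parabolic (~` J).
Proof.
apply/seteqP; split=> x.
  move=> Ax; have [w [_ w_uniq]] := reduced_subword (pres_repr x).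
  rewrite pres_reprK => pw_x; rewrite -pw_x; apply: parabolic_word => l lw Jl.
  have := Ax l.1 Jl; rewrite -pw_x => /(parabolic_reduced w_uniq) /(_ l lw).
  exact.
move=> Jx F JF; apply: generatedS x Jx; apply: image_subset => E JE EF.
by apply: JE; rewrite EF.
Qed.

End Reflections.

(** * Flags of a polytope and the generation of its automorphism group *)

Section Flags.
Import Order.Theory.
Local Open Scope card_scope.
Local Open Scope order_scope.
Local Open Scope classical_set_scope.
Variables (d : Order.disp_t) (P : tbPOrderType d) (n : nat).
Implicit Types (Phi Psi : set P) (s : seq P) (x y F G : P).

Lemma flag_mem Phi y :
  flag Phi -> (forall x, Phi x -> x >=< y) -> Phi y.
Proof.
move=> [chPhi maxPhi] Phiy; rewrite -(maxPhi (y |` Phi)); first by left.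
  move=> u v [->|Pu] [->|Pv]; first by left.
  - by have /orP[] := Phiy v Pv; [right | left].
  - by have /orP[] := Phiy u Pu; [left | right].
  - exact: chPhi.
by move=> x; right.
Qed.

(** Zorn's lemma, applied to the sets whose union with {x} is a chain. *)
Lemma flag_exists x : exists2 Phi, flag Phi & Phi x.
Proof.
have [|A [chA maxA]] := @Zorn_bigcup P (fun A => chain (x |` A)).
  move=> C CP Ctot u v.
  have Cx w : (\bigcup_(X in C) X) w -> (x <= w) || (w <= x).
    move=> [X CX Xw].
    have [] := CP X CX x w (or_introl erefl) (or_intror Xw) => -> //.
    by rewrite orbT.
  move=> [->|[X CX Xu]] [->|[Y CY Yv]]; first by left.
  - by apply/orP/Cx; exists Y.
  - by apply/orP; rewrite orbC; apply: Cx; exists X.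
  - have [XY|YX] := Ctot X Y CX CY.
      by apply: (CP Y CY); right => //; apply: XY.
    by apply: (CP X CX); right => //; apply: YX.
exists (x |` A); last by left.
split=> // Psi chPsi APsi; apply/seteqP; split=> // y Psiy.
apply: contrapT => nAy; apply: (maxA (y |` A)).
  split=> [z Az|]; first by right.
  by move=> /(_ y (or_introl erefl)) Ay; apply: nAy; right.
move=> u v Au Av; apply: chPsi.
  by case: Au => [->|[->|Au]] //; apply: APsi; [left | right].
by case: Av => [->|[->|Av]] //; apply: APsi; [left | right].
Qed.

Lemma card_set_seq (T : choiceType) (s : seq T) :
  uniq s -> [set` s] #= `I_(size s).
Proof.
elim: s => [_|x s IH /= /andP[xs s_uniq]].
  by rewrite set_nil II0 card_eq00.
apply/eq_cardSP; exists x; first by rewrite /= inE eqxx.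
rewrite (_ : _ `\ x = [set` s]) ?IH //.
apply/seteqP; split=> y /=; rewrite inE.
  by move=> [/orP[/eqP ->|] //].
by move=> ys; rewrite ys orbT; split=> // yx; rewrite -yx ys in xs.
Qed.

Lemma chain_sorted s : sorted <%O s -> chain [set` s].
Proof.
rewrite lt_sorted_pairwise => s_lt x y /= xs ys; apply/orP.
elim: s s_lt xs ys => //= z s IH /andP[/allP zs s_lt].
rewrite !inE => /orP[/eqP ->|xs] /orP[/eqP ->|ys]; first by rewrite lexx.
- by rewrite ltW ?zs.
- by rewrite orbC ltW ?zs.
- exact: IH.
Qed.

(** Finite flags are handled as increasing sequences, so that the level of a
face becomes its index. *)
Definition flag_seq s := sorted <%O s /\ flag [set` s].

Hypothesis flag_card : forall Phi, flag Phi -> Phi #= `I_n.+2.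

Lemma flag_seqP Phi : flag Phi -> exists2 s, flag_seq s & Phi = [set` s].
Proof.
move=> Phi_flag; have /finite_seqP [s0 Phi_s0] : finite_set Phi.
  by exists n.+2; apply: flag_card.
pose s := sort <=%O (undup s0).
have PhiE : Phi = [set` s].
  by rewrite Phi_s0; apply/seteqP; split=> x /=; rewrite mem_sort mem_undup.
exists s => //; split; last by rewrite -PhiE.
rewrite lt_sorted_uniq_le sort_uniq undup_uniq /=.
apply: (@sort_sorted_in _ (mem s0)); last first.
  by apply/allP => x; rewrite mem_undup.
by case: Phi_flag => chPhi _ x y xs ys; apply/orP/chPhi; rewrite Phi_s0.
Qed.

Lemma flag_seq_size s : flag_seq s -> size s = n.+2.
Proof.
move=> [s_lt s_flag]; apply/card_eq_II.
rewrite -(card_eql (card_set_seq (lt_sorted_uniq s_lt))).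
exact: flag_card.
Qed.

Lemma flag_seq_total s x y : flag_seq s -> x \in s -> y \in s -> x >=< y.
Proof. by move=> [_ [chs _]] xs ys; apply/orP/chs. Qed.

Lemma flag_splice s1 s2 x :
    flag_seq s1 -> flag_seq s2 -> x \in s1 -> x \in s2 ->
  flag_seq ([seq y <- s1 | y < x] ++ [seq y <- s2 | x <= y]).
Proof.
move=> f1 f2 x1 x2; have [s1_lt F1] := f1; have [s2_lt F2] := f2.
set t := _ ++ _.
have t_lt : sorted <%O t.
  rewrite lt_sorted_pairwise pairwise_cat -!lt_sorted_pairwise.
  rewrite !lt_sorted_filter // !andbT; apply/allrelP => y z.
  rewrite !mem_filter => /andP[yx _] /andP[xz _].
  exact: lt_le_trans xz.
split=> //; split; first exact: chain_sorted.
move=> Psi chPsi tPsi; apply/seteqP; split=> // y Psiy.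
have xy : y >=< x.
  apply/orP/chPsi => //; apply: tPsi.
  by rewrite /= mem_cat !mem_filter lexx x2 orbT.
have yt z : z \in t -> z >=< y.
  by move=> zt; apply/orP/chPsi => //; apply: tPsi.
rewrite /= mem_cat !mem_filter.
have [yx|xley] := comparable_ltP xy.
  apply/orP; left; apply: (flag_mem F1) => z /= z1.
  have [zx|xz] := comparable_ltP (flag_seq_total f1 z1 x1).
    by apply: yt; rewrite mem_cat mem_filter zx z1.
  by rewrite /Order.comparable orbC (ltW (lt_le_trans yx xz)).
apply/orP; right; apply: (flag_mem F2) => z /= z2.
have [zx|xz] := comparable_ltP (flag_seq_total f2 z2 x2).
  by rewrite /Order.comparable (le_trans (ltW zx) xley).
by apply: yt; rewrite mem_cat !mem_filter xz z2 orbT.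
Qed.

(** The flag made of the part of s1 below x and the part of s2 above x has as
many faces as s2 has. *)
Lemma flag_seq_rank s1 s2 x : flag_seq s1 -> flag_seq s2 ->
  x \in s1 -> x \in s2 -> count (< x) s1 = count (< x) s2.
Proof.
move=> f1 f2 x1 x2.
have := flag_seq_size (flag_splice f1 f2 x1 x2).
rewrite size_cat !size_filter -(flag_seq_size f2) -(count_predC (< x) s2).
rewrite (@eq_in_count _ (predC (< x)) (>= x)); first by move/addIn.
by move=> y y2 /=; have [] := comparable_ltP (flag_seq_total f2 y2 x2).
Qed.

Lemma flag_seq_nth s1 s2 j : flag_seq s1 -> flag_seq s2 -> (j < n.+2)%N ->
  nth \bot s1 j \in s2 -> nth \bot s2 j = nth \bot s1 j.
Proof.
move=> f1 f2 jn x2; have [s1_lt _] := f1; have [s2_lt _] := f2.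
have j1 : (j < size s1)%N by rewrite flag_seq_size.
have := flag_seq_rank f1 f2 (mem_nth _ j1) x2.
rewrite count_lt_nth // -{1}(nth_index \bot x2) count_lt_nth ?index_mem //.
move=> jE.
by rewrite {1}jE nth_index.
Qed.

Lemma flag_seq_bot s : flag_seq s -> nth \bot s 0 = \bot.
Proof.
move=> f; have [s_lt F] := f.
have bs : \bot \in s.
  by apply: (flag_mem F) => x _; rewrite /Order.comparable le0x orbT.
have := le0x (nth \bot s 0); rewrite -{1}(nth_index \bot bs).
have s0 : (0 < size s)%N by rewrite flag_seq_size.
rewrite (lt_sorted_leq_nth _ s_lt) ?inE ?index_mem // leqn0 => /eqP <-.
by rewrite nth_index.
Qed.

Lemma flag_seq_top s : flag_seq s -> nth \bot s n.+1 = \top.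
Proof.
move=> f; have [s_lt F] := f.
have ts : \top \in s.
  by apply: (flag_mem F) => x _; rewrite /Order.comparable lex1.
have := lex1 (nth \bot s n.+1); rewrite -{1}(nth_index \bot ts).
have sn := flag_seq_size f.
rewrite (lt_sorted_leq_nth _ s_lt) ?inE ?index_mem // ?sn // => le1.
have := ts; rewrite -index_mem sn ltnS => le2.
by rewrite (@anti_leq n.+1 (index \top s)) ?nth_index // le1.
Qed.

Lemma level_nth s k : flag_seq s -> (k < n.+2)%N -> level k (nth \bot s k).
Proof.
move=> f kn; have [s_lt F] := f.
have ks : (k < size s)%N by rewrite flag_seq_size.
exists [set` s]; split=> //; first exact: mem_nth.
rewrite (_ : mkset _ = [set` [seq x <- s | x < nth \bot s k]]); last first.
  apply/seteqP; split=> x /=; rewrite mem_filter; first by move=> [-> ->].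
  by move=> /andP[].
rewrite filter_lt_nth // -{2}(size_takel (ltnW ks)).
by apply: card_set_seq; rewrite take_uniq // lt_sorted_uniq.
Qed.

Lemma level_nth_eq s k x :
  flag_seq s -> x \in s -> level k x -> nth \bot s k = x.
Proof.
move=> f xs [Phi [Phi_flag Phix]].
have [s' f' PhiE] := flag_seqP Phi_flag; move: Phix; rewrite PhiE /= => xs'.
have [s_lt F] := f; have [s'_lt F'] := f'.
rewrite (_ : mkset _ = [set` [seq y <- s' | y < x]]); last first.
  apply/seteqP; split=> y /=; rewrite mem_filter; first by move=> [-> ->].
  by move=> /andP[].
rewrite (card_eql (card_set_seq _)) ?filter_uniq ?lt_sorted_uniq //.
rewrite size_filter (flag_seq_rank f' f xs' xs) => /card_eq_II <-.
by rewrite -{1}(nth_index \bot xs) count_lt_nth ?index_mem // nth_index.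
Qed.

(** Common faces have the same index in both flags, so the exchanged faces F
and G also have a common index; it is neither the first nor the last one, since
both flags start with the least face and end with the greatest. *)
Lemma adjacent_nth s Psi F G : flag_seq s -> flag Psi ->
    [set` s] `\` Psi = [set F] -> Psi `\` [set` s] = [set G] ->
  exists2 i : 'I_n, nth \bot s i.+1 = F &
    level i.+1 G /\ nth \bot s i < G < nth \bot s i.+2.
Proof.
move=> f Psi_flag sF sG; have [s' f' PsiE] := flag_seqP Psi_flag.
rewrite PsiE in sF sG; have [s'_lt _] := f'.
have [/= Fs /negP Fs'] : ([set` s] `\` [set` s']) F by rewrite sF.
have [/= Gs' /negP Gs] : ([set` s'] `\` [set` s]) G by rewrite sG.
have sn := flag_seq_size f; have s'n := flag_seq_size f'.
set j := index F s; have jn : (j < n.+2)%N by rewrite -sn index_mem.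
have jF : nth \bot s j = F by rewrite nth_index.
have common i : (i < n.+2)%N -> i != j -> nth \bot s' i = nth \bot s i.
  move=> i_lt ij; apply: flag_seq_nth => //; apply: contrapT => nis'.
  have : ([set` s] `\` [set` s']) (nth \bot s i).
    by split=> //=; rewrite mem_nth ?sn.
  rewrite sF /= -jF => /eqP; rewrite nth_uniq ?sn //; first exact/negP.
  by have [/lt_sorted_uniq] := f.
have jG : nth \bot s' j = G.
  rewrite -(nth_index \bot Gs'); congr nth; apply/esym/eqP.
  apply: contraNT Gs => ij; rewrite -(nth_index \bot Gs') common //.
    by rewrite mem_nth // sn -s'n index_mem.
  by rewrite -s'n index_mem.
have j0 : j != 0%N.
  apply: contraNneq Fs' => jE.
  by rewrite -jF jE flag_seq_bot // -(flag_seq_bot f') mem_nth ?s'n.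
have jn1 : j != n.+1.
  apply: contraNneq Fs' => jE.
  by rewrite -jF jE flag_seq_top // -(flag_seq_top f') mem_nth ?s'n.
have j_gt0 : (j.-1 < n)%N.
  by rewrite -ltnS prednK ?lt0n // ltn_neqAle jn1 -ltnS.
exists (Ordinal j_gt0) => /=; rewrite prednK ?lt0n //; split.
  by rewrite -jG; apply: level_nth.
have j1n : (j.+1 < n.+2)%N by rewrite ltnS ltn_neqAle jn1 -ltnS.
have j1j : (j.-1 < j)%N by rewrite prednK ?lt0n.
have s1 : nth \bot s j.-1 = nth \bot s' j.-1.
  by rewrite common ?(leq_trans j1j) 1?ltnW // neq_ltn j1j.
have s2 : nth \bot s j.+1 = nth \bot s' j.+1.
  by rewrite common // neq_ltn ltnSn orbT.
rewrite s1 s2 -jG !(lt_sorted_ltn_nth _ s'_lt) ?inE ?s'n //.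
  by rewrite j1j ltnSn.
by rewrite (leq_trans j1j) // ltnW.
Qed.

Hypothesis P_diamond : diamond P.

(** F, G and G' are among the two faces that the diamond condition allows
between the neighbours of F in Phi, and neither G nor G' is F. *)
Lemma adjacent_unique Phi Psi Psi' F G G' : flag Phi -> flag Psi -> flag Psi' ->
    Phi `\` Psi = [set F] -> Psi `\` Phi = [set G] ->
    Phi `\` Psi' = [set F] -> Psi' `\` Phi = [set G'] ->
  Psi = Psi'.
Proof.
move=> /flag_seqP [s f ->] Psi_flag Psi'_flag sF sG sF' sG'.
have [s_lt _] := f; have sn := flag_seq_size f.
have [i iF [lG bG]] := adjacent_nth f Psi_flag sF sG.
have [i' i'F [lG' bG']] := adjacent_nth f Psi'_flag sF' sG'.
have ii' : i' = i.
  apply/val_inj/eqP; rewrite -eqSS -(@nth_uniq _ \bot s) ?i'F ?iF //.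
  - by rewrite sn !ltnS ltnW ?ltn_ord.
  - by rewrite sn !ltnS ltnW ?ltn_ord.
  - exact: lt_sorted_uniq.
rewrite {}ii' in i'F lG' bG'.
have i2 : (i.+2 < n.+2)%N by rewrite !ltnS.
have i1 : (i.+1 < n.+2)%N by apply: ltnW.
have i0 : (i < n.+2)%N by apply: ltnW.
have bF : nth \bot s i < F < nth \bot s i.+2.
  rewrite -iF !(lt_sorted_ltn_nth _ s_lt) ?inE ?sn //.
  by rewrite !ltnSn.
have [|H1 [H2 [_ H12]]] :=
    P_diamond (level_nth f i0) (level_nth f i2).
  by case/andP: bF; apply: lt_trans.
have F12 : [set H1; H2] F.
  by rewrite -H12; split=> //; rewrite -iF; apply: level_nth.
have G12 : [set H1; H2] G by rewrite -H12.
have G'12 : [set H1; H2] G' by rewrite -H12.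
have [/= Fs Fs'] : ([set` s] `\` Psi) F by rewrite sF.
have [/= Gs' Gs] : (Psi `\` [set` s]) G by rewrite sG.
have [/= G's' G's] : (Psi' `\` [set` s]) G' by rewrite sG'.
have GG' : G = G'.
  have GF : G <> F by move=> GF; apply: Gs; rewrite GF.
  have G'F : G' <> F by move=> G'F; apply: G's; rewrite G'F.
  by case: F12 => ?; case: G12 => ?; case: G'12 => ?; congruence.
have PsiE (X : set P) :
    X = ([set` s] `\` ([set` s] `\` X)) `|` (X `\` [set` s]).
  by rewrite setDD setIC setUIDK.
by rewrite (PsiE Psi) (PsiE Psi') sF sG sF' sG' GG'.
Qed.

Lemma aut_inj (g : order_aut P) : injective [eta g].
Proof. exact: can_inj (@oaut_funK _ _ g). Qed.

Lemma aut_image1 Phi : (1%g : order_aut P) @` Phi = Phi.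
Proof. exact: image_id. Qed.

Lemma aut_imageM (g h : order_aut P) Phi : (g * h)%g @` Phi = g @` (h @` Phi).
Proof. by rewrite image_comp. Qed.

Lemma aut_flag (g : order_aut P) Phi : flag Phi -> flag (g @` Phi).
Proof.
move=> [chPhi maxPhi]; split=> [_ _ [x Px <-] [y Py <-]|Psi chPsi gPhi].
  by rewrite !oaut_mono; apply: chPhi.
have PsiE : g @^-1` Psi = Phi.
  apply: maxPhi => [x y Px Py|x Px]; last by apply: gPhi; exists x.
  by have := chPsi _ _ Px Py; rewrite !oaut_mono.
rewrite -PsiE; apply/seteqP; split=> [y Psiy|_ [x /= Px <-] //].
by exists (oaut_inv g y); rewrite /= oaut_invK.
Qed.

Lemma aut_setD (g : order_aut P) Phi Psi F : Phi `\` Psi = [set F] ->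
  g @` Phi `\` g @` Psi = [set g F].
Proof.
move=> D; rewrite -image_set1 -D; apply/seteqP; split.
  by move=> _ [[x Px <-] nx]; exists x => //; split.
move=> _ [x [Px nx] <-]; split; first by exists x.
by move=> [y Psiy /aut_inj yx]; apply: nx; rewrite -yx.
Qed.

(** An increasing sequence has no nontrivial order-preserving permutation. *)
Lemma aut_fix_flag (g : order_aut P) Phi : flag Phi -> g @` Phi = Phi ->
  forall x, Phi x -> g x = x.
Proof.
move=> /flag_seqP [s [s_lt _] ->] /seteqP [gs sg].
suff /eq_in_map gE : map g s = map id s by move=> x /gE.
rewrite map_id; apply: lt_sorted_eq => //.
  rewrite sorted_map (eq_sorted (e' := <%O)) // => x y /=.
  exact: (leW_mono (@oaut_mono _ _ g)).
move=> x; apply/mapP/idP => [[y ys ->]|xs].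
  by apply: gs; exists y.
by have [y ys yx] := sg x xs; exists y.
Qed.

Hypothesis P_connected : strongly_flag_connected P.

Lemma flag_induction (Q : set P -> Prop) Phi : flag Phi -> Q Phi ->
    (forall Psi Psi', adjacent Psi Psi' -> Q Psi -> Q Psi') ->
  forall Psi, flag Psi -> Q Psi.
Proof.
move=> Phi_flag QPhi Qadj Psi Psi_flag.
move: QPhi; have := P_connected Phi_flag Psi_flag.
elim=> [X Y [/Qadj + _ _]||X Y Z _ XY _ YZ QX] //; exact/YZ/XY.
Qed.

(** If g fixes Psi, it maps a neighbour of Psi to a neighbour of Psi that
differs from it in the same face. So g fixes every flag, hence every face. *)
Lemma aut_free (g : order_aut P) Phi : flag Phi -> g @` Phi = Phi ->
  g = 1%g.
Proof.
move=> Phi_flag gPhi; apply: order_aut_eq => x.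
have [Psi Psi_flag Psix] := flag_exists x.
apply: aut_fix_flag Psix => //; move: Psi Psi_flag {x}.
apply: (flag_induction Phi_flag gPhi).
move=> Psi Psi' [PsiF Psi'F [F [G [D D']]]] gPsi.
apply: (@adjacent_unique Psi _ _ F (g G) G) => //; first exact: aut_flag.
  rewrite -{1}gPsi (aut_setD g D) (aut_fix_flag PsiF gPsi) //.
  by have [] : (Psi `\` Psi') F by rewrite D.
by rewrite -{1}gPsi (aut_setD g D').
Qed.

Variables (Phi : set P) (rho : 'I_n -> order_aut P).
Hypotheses (Phi_flag : flag Phi) (rho_dist : distinguished_generators Phi rho).

(** Every position of Phi but the first and the last is the one of some rho_i,
and Phi has a single neighbour there. *)
Lemma adjacent_base Psi : adjacent Phi Psi -> exists i, Psi = rho i @` Phi.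
Proof.
move=> [_ Psi_flag [F [G [D D']]]].
have [s f PhiE] := flag_seqP Phi_flag.
have Ds := D; have Ds' := D'; rewrite PhiE in Ds Ds'.
have [i iF _] := adjacent_nth f Psi_flag Ds Ds'.
exists i; have [_ rhoPhi [F' [G' [rD rD' lF' _]]]] := rho_dist i.
apply: (adjacent_unique Phi_flag Psi_flag rhoPhi D D' _ rD').
rewrite rD; congr [set _]; rewrite -iF; apply/esym/level_nth_eq => //.
by have [] : ([set` s] `\` rho i @` Phi) F' by rewrite -PhiE rD.
Qed.

(** If h Phi = Psi with h in <rho> and Psi' is adjacent to Psi, then h^-1 Psi'
is some rho_i Phi, so Psi' = (h rho_i) Phi. Thus g Phi = h Phi for some h in
<rho>, and then g = h. *)
Lemma distinguished_generate (g : order_aut P) : generated (range rho) g.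
Proof.
pose reached Psi :=
  exists2 h : order_aut P, generated (range rho) h & h @` Phi = Psi.
have [h rho_h hg] : reached (g @` Phi).
  move: (g @` Phi) (aut_flag g Phi_flag).
  apply: (flag_induction Phi_flag) => [|Psi Psi' PP' [h rho_h hPhi]].
    by exists 1%g; [apply: generated1 | apply: aut_image1].
  have [PsiF Psi'F [F [G [D D']]]] := PP'.
  have [|i iPsi] := @adjacent_base (h^-1%g @` Psi').
    split=> //; first exact: aut_flag.
    have hPsi : h^-1%g @` Psi = Phi.
      by rewrite -hPhi -aut_imageM mulVg aut_image1.
    exists (h^-1%g F), (h^-1%g G).
    by rewrite -hPsi (aut_setD _ D) (aut_setD _ D').
  exists (h * rho i)%g.
    by apply: generatedM => //; apply: sub_generated; exists i.
  by rewrite aut_imageM -iPsi -aut_imageM mulgV aut_image1.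
have hgPhi : (h^-1 * g)%g @` Phi = Phi.
  by rewrite aut_imageM -hg -aut_imageM mulVg aut_image1.
by rewrite -[g](mulVKg h) (aut_free Phi_flag hgPhi) mulg1.
Qed.

End Flags.

(** * Coset systems of equal subgroups *)

Section CosetSystems.
Local Open Scope group_scope.
Variable G : groupType.

Definition cast_coset (H K : set G) (HK : H = K) :
    left_cosets H -> left_cosets K :=
  let: erefl in _ = K := HK return left_cosets H -> left_cosets K in id.

Lemma cast_coset_bij (H K : set G) (HK : H = K) : bijective (cast_coset HK).
Proof. by case: K / HK; exists id. Qed.

Lemma val_cast_coset (H K : set G) (HK : H = K) C :
  val (cast_coset HK C) = val C.
Proof. by case: K / HK. Qed.

Lemma coset_system_isomorphic (I J : Type) (t : I -> J) (Gs : I -> set G)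
    (Hs : J -> set G) :
  bijective t -> (forall i, Gs i = Hs (t i)) ->
  isomorphic_over t (coset_system Gs) (coset_system Hs).
Proof.
move=> t_bij GH; split=> //; exists (fun i => cast_coset (GH i)); split.
  by move=> i; apply: cast_coset_bij.
by move=> i j x y; rewrite /= !val_cast_coset.
Qed.

End CosetSystems.

(** * Subgroups of a semidirect product *)

Section SemidirectGeneration.
Local Open Scope group_scope.
Variables (B A : groupType) (eta : aut_action B A) (S : set A) (T : set B).
Local Notation orbit_group :=
  (generated [set eta b a | b in generated T & a in S]).

Lemma orbit_group_act b x :
  generated T b -> orbit_group x -> orbit_group (eta b x).
Proof.
move=> Tb; apply: (generated_sub (T := [set x | orbit_group (eta b x)])).
  split=> [|u v /= Su Sv|u /= Su].
  - by rewrite /= sd_act1; apply: generated1.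
  - by rewrite act_morph; apply: generatedM.
  - rewrite (_ : eta b u^-1 = (eta b u)^-1); first exact: generatedV.
    by apply: (mulgI (eta b u)); rewrite -act_morph !mulgV sd_act1.
move=> _ [c Tc [a Sa <-]]; rewrite /= -act_funM; apply: sub_generated.
by exists (b * c); [apply: generatedM | exists a].
Qed.

Lemma sdprodM (x y : sdprod eta) : x * y = (x.1 * eta x.2 y.1, x.2 * y.2).
Proof. by []. Qed.

Lemma sdprodV (x : sdprod eta) : x^-1 = (eta x.2^-1 x.1^-1, x.2^-1).
Proof. by []. Qed.

(** The right side is a subgroup since <T> preserves the first factor, and
(eta b a, 1) is the conjugate of (a, 1) by (1, b). *)
Lemma generated_sdprod :
  generated ([set ((a, 1) : sdprod eta) | a in S] `|`
             [set ((1, b) : sdprod eta) | b in T]) =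
  sd_sub orbit_group (generated T).
Proof.
set R := _ `|` _; apply/seteqP; split.
  apply: generated_sub; first split.
  - by split; apply: generated1.
  - move=> x y [x1 x2] [y1 y2]; split; last exact: generatedM.
    by apply: generatedM => //; apply: orbit_group_act.
  - move=> x [x1 x2]; split; last exact: generatedV.
    by apply: orbit_group_act; apply: generatedV.
  move=> _ [[a Sa <-]|[b Tb <-]]; split=> /=; try exact: generated1.
    apply: sub_generated; exists 1; first exact: generated1.
    by exists a; rewrite // act_fun1.
  exact: sub_generated.
have RT : generated T `<=` [set b | generated R ((1, b) : sdprod eta)].
  apply: generated_sub; first split=> [|b c Rb Rc|b Rb].
  - exact: generated1.
  - rewrite /= (_ : (1, b * c) = ((1, b) : sdprod eta) * (1, c));
      first exact: generatedM.
    by rewrite sdprodM /= sd_act1 mul1g.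
  - rewrite /= (_ : (1, b^-1) = ((1, b) : sdprod eta)^-1);
      first exact: generatedV.
    by rewrite sdprodV /= invg1 sd_act1.
  by move=> b Tb; apply: sub_generated; right; exists b.
have RS : orbit_group `<=` [set a | generated R ((a, 1) : sdprod eta)].
  apply: generated_sub; first split=> [|a c Ra Rc|a Ra].
  - exact: generated1.
  - rewrite /= (_ : (a * c, 1) = ((a, 1) : sdprod eta) * (c, 1));
      first exact: generatedM.
    by rewrite sdprodM /= act_fun1 mul1g.
  - rewrite /= (_ : (a^-1, 1) = ((a, 1) : sdprod eta)^-1);
      first exact: generatedV.
    by rewrite sdprodV /= invg1 act_fun1.
  move=> _ [b Tb [a Sa <-]] /=.
  rewrite (_ : (eta b a, 1) =
      ((1, b) : sdprod eta) * (a, 1) * ((1, b) : sdprod eta)^-1).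
    apply: generatedM; last exact: generatedV (RT _ Tb).
    apply: generatedM; first exact: (RT _ Tb).
    by apply: sub_generated; left; exists a.
  by rewrite sdprodV !sdprodM /= invg1 !sd_act1 !mulg1 mul1g mulgV.
move=> [a b] [/RS Ra /RT Rb].
rewrite (_ : (a, b) = ((a, 1) : sdprod eta) * (1, b)).
  exact: generatedM.
by rewrite sdprodM /= act_fun1 mulg1 mul1g.
Qed.

End SemidirectGeneration.

(** * The twisting of a diagonal Coxeter graph *)

Section DiagonalTwisting.
Local Open Scope group_scope.
Variables (B : groupType) (n : nat) (rho : 'I_n -> B) (i0 : 'I_n).
Local Notation B0 := (maximal_parabolic rho i0).
Variable lambda : diagonal_classes B0 -> label.
Local Notation D := (diagonal_graph lambda).
Local Notation eta := (diagonal_action lambda).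

Lemma diagonal_graph_sym F E (FE : F <> E) (EF : E <> F) : D FE = D EF.
Proof. by congr lambda; apply: val_inj; rewrite /= setUC. Qed.

Lemma bigcap_diagonal_parabolic J :
  \bigcap_(F in J) coxeter_parabolic D F =
  generated [set coxeter_gen D E | E in ~` J].
Proof.
exact/bigcap_coxeter_parabolic/coxeter_gen_inj/diagonal_graph_sym.
Qed.

Hypothesis rho_generate : forall b, generated (range rho) b.

(** [generated_sdprod], applied to {a_F0} and the rho_j with j <> i for rank
i + 1, and to no element of W(D) and all rho_j for rank 0. *)
Lemma two_power_parabolicE k :
  maximal_parabolic (two_power_generator lambda) k =
  twisting_subgroup (eta := eta) (coxeter_parabolic D) (@coset_act B B0)
    (base_coset B0) (maximal_parabolic rho) (unlift ord0 k).
Proof.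
pose a0 := coxeter_gen D (base_coset B0).
have genS (i : 'I_n) : two_power_generator lambda (lift ord0 i) = (1, rho i).
  by rewrite /two_power_generator liftK.
have gen0 : two_power_generator lambda ord0 = (a0, 1).
  by rewrite /two_power_generator unlift_none.
rewrite /maximal_parabolic; case: unliftP => [i ->|->] /=.
  rewrite bigcap_diagonal_parabolic setCK.
  rewrite (_ : [set _ | j in _] =
      [set ((a, 1) : sdprod eta) | a in [set a0]] `|`
      [set ((1, b) : sdprod eta) | b in [set rho j | j in [set j | j <> i]]]).
    rewrite generated_sdprod; congr (sd_sub (generated _) _).
    apply/seteqP; split.
      move=> _ [b Bb [_ -> <-]]; exists (coset_act b (base_coset B0)).
        by exists b.
      by rewrite -diagonal_act_gen.
    move=> _ [_ [b Bb <-] <-]; exists b => //; exists a0 => //.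
    exact: diagonal_act_gen.
  apply/seteqP; split.
    move=> _ [j ji <-]; case: (unliftP ord0 j) ji => [j' ->|->] ji.
      right; exists (rho j'); last by rewrite genS.
      by exists j' => // j'i; apply: ji; rewrite j'i.
    by left; exists a0.
  move=> _ [[_ -> <-]|[_ [j ji <-] <-]].
    by exists ord0.
  exists (lift ord0 j); last exact: genS.
  by move=> /lift_inj.
rewrite bigcap_diagonal_parabolic setCT.
rewrite (_ : [set _ | j in _] =
    [set ((a, 1) : sdprod eta) | a in set0] `|`
    [set ((1, b) : sdprod eta) | b in range rho]).
  rewrite generated_sdprod; congr sd_sub; last by apply/seteqP; split.
  congr generated; apply/seteqP; split; first by move=> _ [? _ [? []]].
  by move=> _ [? []].
rewrite image_set0 set0U; apply/seteqP; split.
  move=> _ [j j0 <-]; case: (unliftP ord0 j) j0 => [j' -> _|->] //.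
  by exists (rho j') => //; rewrite genS.
move=> _ [_ [j _ <-] <-]; exists (lift ord0 j); last exact: genS.
by [].
Qed.

Lemma two_power_twisting :
  isomorphic_over (unlift ord0) (two_power_polytope rho i0 lambda)
    (diagonal_twisting rho i0 lambda).
Proof.
apply: coset_system_isomorphic two_power_parabolicE.
exists (oapp (lift ord0) ord0).
  by move=> k; case: unliftP => [i ->|->].
by case=> [i|]; rewrite /= ?liftK ?unlift_none.
Qed.

End DiagonalTwisting.

(** * The isomorphism *)

Theorem corollary3p7 (d : Order.disp_t) (P : tbPOrderType d) (n : nat)
    (n_gt0 : 0 < n)
    (P_polytope : abstract_polytope P n) (P_regular : regular P)
    (Phi : set P) (Phi_flag : flag Phi)
    (rho : 'I_n -> order_aut P)
    (rho_dist : distinguished_generators Phi rho)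
    (X0_finite :
       finite_set (left_cosets (maximal_parabolic rho (Ordinal n_gt0))))
    (X0_many :
       exists F E : left_cosets (maximal_parabolic rho (Ordinal n_gt0)), F <> E)
    (lambda :
       diagonal_classes (maximal_parabolic rho (Ordinal n_gt0)) -> label) :
  isomorphic_over (unlift ord0)
    (two_power_polytope rho (Ordinal n_gt0) lambda)
    (diagonal_twisting rho (Ordinal n_gt0) lambda).
Proof.
have [flag_card connected diam] := P_polytope.
apply: two_power_twisting => b.
exact: (distinguished_generate flag_card diam connected Phi_flag rho_dist b).
Qed.
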